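(* For $G=(\mathbb{Z}/2)^n$, the sample complexity $k_{\min}$ of discriminating the generalized hidden shift states of $G$ (with $m=|G|$) satisfies $$k_{\min}=\Theta(\log|G|)\qquad (n\to\infty).$$
   Context: Generalized hidden shift states: for a finite group $G$ and $m=|G|$, let $\mathrm{reg}_G$ be the regular representation of $G$ on $\mathbb{C}[G]$ and, for $h\in G$, define the density operator on $\mathbb{C}^{m}\otimes\mathbb{C}[G]$ $$\tilde\rho_h=\frac{1}{m|G|}\sum_{b,c\in\mathbb{Z}/m}|b\rangle\langle c|\otimes \mathrm{reg}_G(h^{b-c}).$$ (Up to a unitary independent of $h$, this is $\frac1{|G|}\sum_{g\in G}|\phi_{g,h}\rangle\langle\phi_{g,h}|$ with $|\phi_{g,h}\rangle=\frac1{\sqrt m}\sum_{b\in\mathbb{Z}/m}|b,gh^b\rangle$.) For an ensemble $(p_i,\sigma_i)_i$ the optimal success probability is $p^*_{\mathrm{succ}}=\max\{\sum_i p_i\mathrm{tr}(M_i\sigma_i): M_i\ge0,\ \sum_iM_i=\mathbb 1\}$. Sample complexity: $k_{\min}$ is the least $k\ge1$ such that the ensemble $\{(\tfrac1{|G|},\tilde\rho_h^{\otimes k})\}_{h\in G}$ has $p^*_{\mathrm{succ}}\ge\frac23$. *)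

(* Defs.v *)
From HB Require Import structures.
From mathcomp Require Import all_boot all_order all_algebra all_fingroup.
From mathcomp Require Import mxrepresentation.
From mathcomp Require Import complex mxtens.
From mathcomp Require Import all_classical all_reals all_analysis.

Set Implicit Arguments.
Unset Strict Implicit.
Unset Printing Implicit Defensive.

Import Order.TTheory GRing.Theory Num.Theory.
Import numFieldNormedType.Exports.

Local Open Scope classical_set_scope.
Local Open Scope complex_scope.
Local Open Scope sesquilinear_scope.
Local Open Scope ring_scope.

(* Over the complex numbers this implies that [A] is Hermitian. *)
Definition psdmx (R : realType) (d : nat) (A : 'M[R[i]]_d) : Prop :=
  forall v : 'cV[R[i]]_d, 0 <= (v ^t* *m A *m v) 0 0.

Definition povm (R : realType) (I : finType) (d : nat)
    (M : I -> 'M[R[i]]_d) : Prop :=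
  (forall i, psdmx (M i)) /\ \sum_i M i = 1%:M.

(* The traces are real when the [sigma i] are density operators, and the
   supremum is then a maximum because the set of measurements is compact. *)
Definition success_probability (R : realType) (I : finType) (d : nat)
    (p : I -> R) (sigma : I -> 'M[R[i]]_d) : R :=
  sup [set \sum_i p i * complex.Re (\tr (M i *m sigma i))
      | M in [set M : I -> 'M[R[i]]_d | povm M]].

(* Here m = |G|: the indices [b] and [c] are the representatives in [0, m) of
   elements of Z/m, and h^(b - c) depends only on their classes since the order
   of [h] divides m. [regular_repr] is a homomorphism sending [x] to the
   permutation matrix of g |-> g x on row vectors, i.e. to g |-> g x^-1 on
   column vectors. *)
Definition hidden_shift_state (R : realType) (gT : finGroupType) (h : gT) :
    'M[R[i]]_(#|gT| * gcard [set: gT]) :=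
  (#|gT| * #|gT|)%:R^-1 *:
    \sum_(b < #|gT|) \sum_(c < #|gT|)
      delta_mx b c *t regular_repr R[i] [set: gT]%G (h ^+ b * h ^- c)%g.

Definition discriminable (R : realType) (gT : finGroupType) (k : nat) : Prop :=
  2 / 3 <= success_probability (fun _ : gT => (#|gT|%:R : R)^-1)
             (fun h : gT => ntensmx (hidden_shift_state R h) k).

Definition is_sample_complexity (R : realType) (gT : finGroupType) (k : nat) :
    Prop :=
  [/\ (1 <= k)%N, discriminable R gT k
    & forall l : nat, (1 <= l)%N -> discriminable R gT l -> (k <= l)%N].

(* Main.v *)
Require Import Defs.
From HB Require Import structures.
From mathcomp Require Import all_boot all_order all_algebra all_fingroup.
From mathcomp Require Import cyclic mxrepresentation complex mxtens.
From mathcomp Require Import ring lra.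
From mathcomp Require Import all_classical all_reals all_analysis.

Set Implicit Arguments.
Unset Strict Implicit.
Unset Printing Implicit Defensive.

Import Order.TTheory GRing.Theory Num.Theory.
Import numFieldNormedType.Exports.
Local Open Scope classical_set_scope.
Local Open Scope ring_scope.
Local Open Scope sesquilinear_scope.

(** For abelian G with N = |G|, the operators Q_h = N rho_h are commuting
    projectors of trace N, and tr (Q_g Q_h) counts the c < N with
    (g^-1 h)^c = 1, which is at most N / 2 when g <> h.  Testing the projectors
    Q_h^{(x) k} one after the other therefore succeeds with probability at least
    1 - N / 2^k by the union bound, so that n + 2 samples suffice for
    G = (Z/2)^n.  Conversely h^b depends only on the parity of b in this group,
    hence all the Q_h lie under a single projector P of trace 2N, and every
    measurement succeeds with probability at most
    tr (P^{(x) k}) / N^(k+1) = 2^k / N; thus n samples are necessary. *)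

(** * Products and traces of tensor powers *)

Section TensorPower.
Variable C : comNzRingType.

Lemma mxtrace_tens m n (A : 'M[C]_m) (B : 'M[C]_n) :
  \tr (A *t B) = \tr A * \tr B.
Proof.
rewrite /mxtrace mulr_sum; apply: eq_bigr => i _.
by rewrite mxE.
Qed.

Lemma ntensmx_mul m n p (A : 'M[C]_(m, n)) (B : 'M[C]_(n, p)) k :
  ntensmx (A *m B) k = ntensmx A k *m ntensmx B k.
Proof.
elim: k => [|[|k] IH]; rewrite ?ntensmx1 ?mul1mx //.
by rewrite !ntensmxSS IH tensmx_mul.
Qed.

Lemma ntensmxZ m n a (A : 'M[C]_(m, n)) k :
  ntensmx (a *: A) k = a ^+ k *: ntensmx A k.
Proof.
elim: k => [|[|k] IH]; rewrite ?scale1r //.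
rewrite !ntensmxSS IH (exprS a k.+1); apply/matrixP=> i j; rewrite !mxE.
by rewrite mulrACA.
Qed.

Lemma mxtrace_ntens n (A : 'M[C]_n) k : \tr (ntensmx A k) = (\tr A) ^+ k.
Proof.
elim: k => [|[|k] IH]; first by rewrite mxtrace1.
  by rewrite ntensmx1 expr1.
by rewrite ntensmxSS mxtrace_tens IH -exprS.
Qed.

End TensorPower.

(** * Orthogonal projectors, positivity of traces, and sequential measurement *)

Section Projector.
Variable C : numClosedFieldType.

Lemma adjmx_mul m n p (A : 'M[C]_(m, n)) (B : 'M[C]_(n, p)) :
  (A *m B)^t* = B^t* *m A^t*.
Proof. by rewrite trmx_mul map_mxM. Qed.

Lemma adjmx1 n : (1%:M : 'M[C]_n)^t* = 1%:M.
Proof. by rewrite trmx1 map_mx1. Qed.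

Lemma adjmx_tens m n p q (A : 'M[C]_(m, n)) (B : 'M[C]_(p, q)) :
  (A *t B)^t* = A^t* *t B^t*.
Proof. by rewrite trmx_tens map_mxT. Qed.

Lemma adjmx_ntens m n (A : 'M[C]_(m, n)) k :
  (ntensmx A k)^t* = ntensmx (A^t*) k.
Proof.
elim: k => [|[|k] IH] //; first exact: adjmx1.
by rewrite !ntensmxSS adjmx_tens IH.
Qed.

Definition projmx n (A : 'M[C]_n) : Prop := A^t* = A /\ A *m A = A.

Lemma projmx1 n : projmx (1%:M : 'M[C]_n).
Proof. by split; rewrite ?adjmx1 ?mul1mx. Qed.

Lemma projmx0 n : projmx (0 : 'M[C]_n).
Proof. by split; rewrite ?trmx0 ?map_mx0 ?mulmx0. Qed.

Lemma projmxM n (A B : 'M[C]_n) :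
  projmx A -> projmx B -> A *m B = B *m A -> projmx (A *m B).
Proof.
move=> [Ah Ai] [Bh Bi] AB; split; first by rewrite adjmx_mul Ah Bh.
by rewrite mulmxA -(mulmxA A) -AB mulmxA Ai -mulmxA Bi.
Qed.

(** Taking adjoints in [A *m B = B] gives [B *m A = B], so the square of [A - B] collapses to
    [A - B]. *)
Lemma projmxB n (A B : 'M[C]_n) :
  projmx A -> projmx B -> A *m B = B -> projmx (A - B).
Proof.
move=> [Ah Ai] [Bh Bi] AB.
have BA : B *m A = B by rewrite -{1}Bh -{1}Ah -adjmx_mul AB Bh.
split; first by rewrite linearB map_mxB Ah Bh.
by rewrite mulmxBl !mulmxBr Ai Bi AB BA subrr subr0.
Qed.

Lemma projmx_ntens n (A : 'M[C]_n) k : projmx A -> projmx (ntensmx A k).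
Proof.
by case=> Ah Ai; split; [rewrite adjmx_ntens Ah | rewrite -ntensmx_mul Ai].
Qed.

Lemma mxtrace_adj_mul_ge0 m n (A : 'M[C]_(m, n)) : 0 <= \tr (A^t* *m A).
Proof.
apply: sumr_ge0 => i _; rewrite mxE; apply: sumr_ge0 => j _.
by rewrite !mxE mulrC mul_conjC_ge0.
Qed.

Lemma projmx_trace_ge0 n (A : 'M[C]_n) : projmx A -> 0 <= \tr A.
Proof. by case=> Ah Ai; rewrite -Ai -{1}Ah mxtrace_adj_mul_ge0. Qed.

Lemma projmx_form_ge0 n (A : 'M[C]_n) (v : 'cV[C]_n) :
  projmx A -> 0 <= (v^t* *m A *m v) 0 0.
Proof.
case=> Ah Ai; rewrite -trace_mx11 -Ai -{1}Ah mulmxA -adjmx_mul -mulmxA.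
exact: mxtrace_adj_mul_ge0.
Qed.

(** The trace equals that of [A^t* *m M *m A], whose diagonal entries are the values of the form of
    [M] at the columns of [A]. *)
Lemma mxtrace_mul_projmx_ge0 n (M A : 'M[C]_n) :
  (forall v : 'cV_n, 0 <= (v^t* *m M *m v) 0 0) -> projmx A ->
  0 <= \tr (M *m A).
Proof.
move=> M_ge0 [Ah Ai]; rewrite -Ai mulmxA mxtrace_mulC mulmxA.
rewrite -{1}Ah; apply: sumr_ge0 => i _.
have -> : (A^t* *m M *m A) i i = ((col i A)^t* *m M *m col i A) 0 0.
  have -> : (A^t* *m M *m A) i i = col i (row i (A^t* *m M *m A)) 0 0.
    by rewrite !mxE.
  rewrite colE rowE colE adjmx_mul trmx_delta map_delta_mx.
  by rewrite !mulmxA.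
exact: M_ge0.
Qed.

(** Completeness splits [\tr P] into the sum of the [\tr (M i *m P)], and each [P - Q i] is a
    projector, hence has nonnegative trace against [M i]. *)
Lemma trace_povm_projmx_le (I : finType) n (M Q : I -> 'M[C]_n) (P : 'M[C]_n) :
  (forall i (v : 'cV_n), 0 <= (v^t* *m M i *m v) 0 0) ->
  \sum_i M i = 1%:M ->
  projmx P -> (forall i, projmx (Q i)) -> (forall i, P *m Q i = Q i) ->
  \sum_i \tr (M i *m Q i) <= \tr P.
Proof.
move=> M_ge0 M1 P_proj Q_proj PQ.
rewrite -[P in leRHS]mul1mx -M1 mulmx_suml raddf_sum /=.
apply: ler_sum => i _; rewrite -subr_ge0 -raddfB -mulmxBr.
by apply: mxtrace_mul_projmx_ge0 => //; apply: projmxB.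
Qed.

(* The outcomes in [s] are tested one after the other and the measurement stops
   at the first success; [L] is the event that every test fails. *)
Lemma sequential_measurement (I : eqType) n (Q : I -> 'M[C]_n) (s : seq I) :
  (forall i, projmx (Q i)) -> (forall i j, Q i *m Q j = Q j *m Q i) -> uniq s ->
  exists (M : I -> 'M[C]_n) (L : 'M[C]_n),
    [/\ (forall i, projmx (M i)) /\ projmx L, \sum_(i <- s) M i + L = 1%:M,
        forall i, i \in s ->
          \tr (Q i) - \sum_(j <- s | j != i) \tr (Q j *m Q i)
            <= \tr (M i *m Q i),
        forall i, \tr (Q i) - \sum_(j <- s) \tr (Q j *m Q i) <= \tr (L *m Q i)
      & forall i, L *m Q i = Q i *m L].
Proof.
move=> Q_proj QC; elim: s => [_|x s IH /= /andP[xs s_uniq]].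
  (* Without any test, failure is certain; the identity is a default value for outcomes outside the
     list. *)
  exists (fun=> 1%:M), 1%:M; split.
  - by split=> [i|]; exact: projmx1.
  - by rewrite big_nil add0r.
  - by [].
  - by move=> i; rewrite big_nil subr0 mul1mx.
  - by move=> i; rewrite mul1mx mulmx1.
have [M [L [[M_proj L_proj] ML1 M_ge L_ge LC]]] := IH s_uniq.
have LQ_proj : projmx (L *m Q x) by apply: projmxM.
have QQ_ge0 i j : 0 <= \tr (Q i *m Q j) by apply/projmx_trace_ge0/projmxM.
(* The head [x] is tested after all of [s]: success then has operator [L *m Q x], and the rest of
   [L] is the new failure event. *)
exists (fun i => if i == x then L *m Q x else M i), (L - L *m Q x); split.
- split=> [i|]; first by case: ifP.
  by apply: projmxB => //; rewrite mulmxA (proj2 L_proj).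
- rewrite big_cons eqxx addrC addrA subrK addrC -[RHS]ML1; congr (_ + _).
  by apply: eq_big_seq => i si; case: eqP => // ix; rewrite -ix si in xs.
(* For [x] itself this is the bound on [L] at [x], the two sums agreeing since [x] is not in [s].
   For the others the new term only weakens the bound. *)
- move=> i; rewrite inE big_cons; case: eqVneq => [-> _|ix /= si].
    rewrite /= -mulmxA (proj2 (Q_proj x)); apply: le_trans (L_ge x).
    rewrite lerD2l lerN2 big_seq [leRHS]big_seq_cond le_eqVlt.
    apply/orP; left; apply/eqP; apply: eq_bigl => j.
    by case: eqVneq => [->|_]; rewrite ?(negbTE xs) ?andbT.
  apply: le_trans (M_ge i si); rewrite opprD addrCA gerDr oppr_le0.
  exact: QQ_ge0.
- move=> i; rewrite big_cons mulmxBl raddfB /= opprD addrCA addrC.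
  apply: lerB; first exact: L_ge.
  (* The loss [\tr (L *m Q x *m Q i)] is at most [\tr (Q x *m Q i)] because [1%:M - L] is a
     projector. *)
  rewrite -subr_ge0 -raddfB -mulmxA -{1}[Q x *m Q i]mul1mx -mulmxBl.
  apply: mxtrace_mul_projmx_ge0; last exact: projmxM.
  move=> v; apply: projmx_form_ge0; apply: projmxB => //; first exact: projmx1.
  by rewrite mul1mx.
- move=> i; rewrite mulmxBl mulmxBr; congr (_ - _); first exact: LC.
  by rewrite -mulmxA QC !mulmxA LC.
Qed.

End Projector.

(** * Blockwise computation on a tensor product *)

Section BlockMatrix.
Variable C : numClosedFieldType.

(** Spelled as a sum of tensor products so that, up to its scalar, [hidden_shift_state] is an
    instance by unfolding; [f b c] is the block at row [b] and column [c]. *)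
Definition tensblock m n (f : 'I_m -> 'I_m -> 'M[C]_n) : 'M[C]_(m * n) :=
  \sum_b \sum_c delta_mx b c *t f b c.

Lemma tensblockE m n (f : 'I_m -> 'I_m -> 'M[C]_n) b c i j :
  tensblock f (mxtens_index (b, i)) (mxtens_index (c, j)) = f b c i j.
Proof.
rewrite /tensblock summxE (bigD1 b) //= summxE (bigD1 c) //=.
rewrite tensmxE mxE !eqxx mul1r !big1 ?addr0 // => [b' b'b|c' c'c].
  rewrite summxE big1 // => c' _.
  by rewrite tensmxE mxE eq_sym (negbTE b'b) mul0r.
by rewrite tensmxE mxE andbC eq_sym (negbTE c'c) mul0r.
Qed.

Lemma tensblockP m n (A B : 'M[C]_(m * n)) :
  (forall b c i j, A (mxtens_index (b, i)) (mxtens_index (c, j)) =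
                   B (mxtens_index (b, i)) (mxtens_index (c, j))) -> A = B.
Proof.
move=> AB; apply/matrixP=> x y.
by case: (mxtens_indexP x) => b i; case: (mxtens_indexP y) => c j.
Qed.

Lemma sum_mxtens m n (F : 'I_(m * n) -> C) :
  \sum_x F x = \sum_(b < m) \sum_(i < n) F (mxtens_index (b, i)).
Proof.
rewrite pair_big /= (reindex (@mxtens_index m n)) /=.
  by apply: eq_bigr => -[].
exists (@mxtens_unindex m n) => z _.
  exact: mxtens_indexK.
exact: mxtens_unindexK.
Qed.

Lemma tensblock_mul m n (f g : 'I_m -> 'I_m -> 'M[C]_n) :
  tensblock f *m tensblock g = tensblock (fun b d => \sum_c f b c *m g c d).
Proof.
apply: tensblockP => b d i j; rewrite tensblockE mxE sum_mxtens summxE.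
apply: eq_bigr => c _; rewrite mxE.
by apply: eq_bigr => k _; rewrite !tensblockE.
Qed.

Lemma tensblock_adj m n (f : 'I_m -> 'I_m -> 'M[C]_n) :
  (tensblock f)^t* = tensblock (fun b c => (f c b)^t* ).
Proof.
apply: tensblockP => b c i j.
by rewrite !(mxE, tensblockE).
Qed.

Lemma tensblock_tr m n (f : 'I_m -> 'I_m -> 'M[C]_n) :
  \tr (tensblock f) = \sum_b \tr (f b b).
Proof.
rewrite /mxtrace sum_mxtens; apply: eq_bigr => b _; apply: eq_bigr => i _.
by rewrite tensblockE.
Qed.

Lemma tensblockZ m n a (f : 'I_m -> 'I_m -> 'M[C]_n) :
  a *: tensblock f = tensblock (fun b c => a *: f b c).
Proof. by apply: tensblockP => b c i j; rewrite mxE !tensblockE mxE. Qed.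

Lemma eq_tensblock m n (f g : 'I_m -> 'I_m -> 'M[C]_n) :
  (forall b c, f b c = g b c) -> tensblock f = tensblock g.
Proof.
by move=> fg; apply: eq_bigr => b _; apply: eq_bigr => c _; rewrite fg.
Qed.

End BlockMatrix.

(** * The regular representation as permutation matrices *)

Section RegularRepresentation.
Variables (C : numClosedFieldType) (gT : finGroupType).
Local Notation G := [set: gT]%G.
Local Notation r := (regular_repr C G).
Local Open Scope group_scope.

Lemma regular_mxE x i j : r x i j = (enum_val j == enum_val i * x)%:R :> C.
Proof.
rewrite /= !mxE eqxx /= -(inj_eq enum_val_inj) gring_indexK ?inE //.
Qed.

Lemma regular_reprM x y : r (x * y) = r x *m r y.
Proof. by rewrite repr_mxM ?inE. Qed.

Lemma regular_repr_adj x : (r x)^t* = r x^-1.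
Proof.
apply/matrixP=> i j; rewrite 2!mxE !regular_mxE rmorph_nat.
by rewrite -[in RHS](inj_eq (mulIg x)) mulgKV eq_sym.
Qed.

(** The trace counts fixed points, and a translation by [x] has none unless [x] is trivial. *)
Lemma regular_repr_tr x : \tr (r x) = (#|gT|%:R * (x == 1%g)%:R : C)%R.
Proof.
have fixed y : (y == y * x) = (x == 1).
  by rewrite -{1}[y]mulg1 (inj_eq (mulgI y)) eq_sym.
rewrite /mxtrace; under eq_bigr do rewrite regular_mxE fixed.
by rewrite sumr_const card_ord /gcard cardsT mulr_natl.
Qed.

End RegularRepresentation.

(** * Sums over the powers of a group element *)

Section AbelianGroup.
Variables (gT : finGroupType).
Local Open Scope group_scope.

(** The powers of [g] are periodic with period [#|gT|], so each unit shift only moves one term from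
    the start of the sum to its end. *)
Lemma sum_powers_shift (V : zmodType) (f : gT -> V) (g : gT) k :
  (\sum_(c < #|gT|) f (g ^+ (k + c))%g = \sum_(c < #|gT|) f (g ^+ c)%g)%R.
Proof.
have gN : g ^+ #|gT| = 1 by rewrite -cardsT expg_cardG ?inE.
elim: k => // k <-; case: #|gT| gN => [|m] gm; first by rewrite !big_ord0.
rewrite big_ord_recr [RHS]big_ord_recl /= addrC addn0; congr (_ + _)%R.
  by rewrite addSnnS expgD gm mulg1.
by apply: eq_bigr => i _; rewrite addSnnS.
Qed.

Lemma sum_powersV (V : zmodType) (f : gT -> V) (g : gT) :
  (\sum_(c < #|gT|) f (g ^- c)%g = \sum_(c < #|gT|) f (g ^+ c)%g)%R.
Proof.
(* Reversal sends [c] to [#|gT| - c.+1], whose inverse power is [g ^+ c.+1]; hence the shift by one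
   on the right. *)
rewrite (reindex_inj rev_ord_inj) -[RHS](sum_powers_shift f g 1).
apply: eq_bigr => c _; congr f; apply/eqP.
rewrite eq_invg_mul -expgD /= add1n subnK //.
by rewrite -cardsT expg_cardG ?inE.
Qed.

End AbelianGroup.

(** * The states rescaled to projectors, and their overlaps *)

Section HiddenShiftProjector.
Variables (R : realType) (gT : finGroupType).
Local Notation C := R[i].
Local Notation N := (#|gT|%:R : C).
Local Notation r := (regular_repr C [set: gT]%G).

Lemma card_group_neq0 (F : numDomainType) : (#|gT|%:R : F) != 0.
Proof. by rewrite pnatr_eq0 -lt0n; apply/card_gt0P; exists 1%g. Qed.

(** The only nonzero eigenvalue of the state is the inverse of [#|gT|], so this multiple is the
    projector onto its support. *)
Definition shift_projector (h : gT) : 'M[C]_(#|gT| * gcard [set: gT]) :=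
  N *: hidden_shift_state R h.

Lemma shift_projectorE h :
  shift_projector h = tensblock (fun b c => N^-1 *: r (h ^+ b * h ^- c)%g).
Proof.
rewrite -tensblockZ /shift_projector /hidden_shift_state scalerA natrM invfM.
by rewrite mulVKf ?card_group_neq0.
Qed.

Lemma shift_projector_mul x y :
  shift_projector x *m shift_projector y =
  tensblock (fun b d =>
    N^-2 *: \sum_(c < #|gT|) r (x ^+ b * x ^- c * (y ^+ c * y ^- d))%g).
Proof.
rewrite !shift_projectorE tensblock_mul; apply: eq_tensblock => b d.
rewrite scaler_sumr; apply: eq_bigr => c _.
by rewrite -scalemxAl -scalemxAr scalerA -regular_reprM -expr2 exprVn.
Qed.

Lemma shift_projector_proj h : projmx (shift_projector h).
Proof.
split.
  rewrite shift_projectorE tensblock_adj; apply: eq_tensblock => b c.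
  rewrite linearZ /= map_mxZ fmorphV rmorph_nat regular_repr_adj.
  by rewrite invMg invgK.
rewrite shift_projector_mul shift_projectorE; apply: eq_tensblock => b d.
(* The middle index cancels, leaving [#|gT|] equal terms that absorb one of the two factors
   [N^-1]. *)
under eq_bigr do rewrite mulgA mulgKV.
rewrite sumr_const card_ord -[r _ *+ _]scaler_nat scalerA -exprVn expr2 -mulrA.
by rewrite mulVf ?mulr1 ?card_group_neq0.
Qed.

Lemma shift_projector_tr h : \tr (shift_projector h) = N.
Proof.
rewrite shift_projectorE tensblock_tr.
under eq_bigr do rewrite linearZ /= mulgV regular_repr_tr eqxx mulr1
  mulVf ?card_group_neq0 //.
by rewrite sumr_const card_ord.
Qed.

Hypothesis mulgC : forall x y : gT, (x * y = y * x)%g.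

Lemma shift_projector_mul_abelian x y :
  shift_projector x *m shift_projector y =
  tensblock (fun b d =>
    N^-2 *: \sum_(c < #|gT|) r (x ^+ b * y ^- d * (x^-1 * y) ^+ c)%g).
Proof.
rewrite shift_projector_mul; apply: eq_tensblock => b d; congr (_ *: _).
apply: eq_bigr => c _; congr (r _); rewrite expgMn; last exact: mulgC.
by rewrite expgVn -!mulgA; congr (_ * _)%g; rewrite mulgA mulgC.
Qed.

(** In block [(b, d)] both products sum over the powers of [x^-1 * y] up to inversion, with
    prefactors [x ^+ b * y ^- d] and [y ^+ b * x ^- d]. These differ by the power [b + d], which a
    shift of the sum absorbs. *)
Lemma shift_projector_comm x y :
  shift_projector x *m shift_projector y =
  shift_projector y *m shift_projector x.
Proof.
rewrite !shift_projector_mul_abelian; apply: eq_tensblock => b d.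
congr (_ *: _).
rewrite -(sum_powers_shift (fun z => r (x ^+ b * y ^- d * z)%g) _ (b + d)).
have -> : (y^-1 * x)%g = (x^-1 * y)^-1%g by rewrite invMg invgK.
under [RHS]eq_bigr do rewrite expgVn.
rewrite (sum_powersV (fun z => r (y ^+ b * x ^- d * z)%g)).
apply: eq_bigr => c _; congr (r _); rewrite expgD mulgA; congr (_ * _)%g.
rewrite expgMn; last exact: mulgC.
rewrite expgVn [(b + d)%N]addnC !expgD invMg (mulgC (x ^+ b)%g) -!mulgA mulKVg.
by rewrite (mulgC (x ^- d)%g) -!mulgA mulKg.
Qed.

(** In the diagonal block [b] the prefactor [x ^+ b * y ^- b] is absorbed by a shift by [b], so all
    [#|gT|] blocks have the same trace. *)
Lemma shift_projector_mul_tr x y :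
  \tr (shift_projector x *m shift_projector y) =
  \sum_(c < #|gT|) ((x^-1 * y) ^+ c == 1)%g%:R.
Proof.
rewrite shift_projector_mul_abelian tensblock_tr.
have tr_block b : \tr (N^-2 *: \sum_(c < #|gT|)
      r (x ^+ b * y ^- b * (x^-1 * y) ^+ c)%g) =
    N^-1 * \sum_(c < #|gT|) ((x^-1 * y) ^+ c == 1)%g%:R.
  rewrite mxtraceZ raddf_sum (eq_bigr _ (fun c _ => regular_repr_tr _ _)).
  rewrite -mulr_sumr mulrA -exprVn expr2 mulfVK ?card_group_neq0 //.
  congr (_ * _).
  rewrite -(sum_powers_shift
    (fun z => ((x ^+ b * y ^- b * z)%g == 1%g)%:R) _ b).
  apply: eq_bigr => c _; rewrite expgD mulgA [X in (_ * X * _)%g]expgMn;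
    last exact: mulgC.
  by rewrite (mulgC (x ^+ b)%g) -!mulgA expgVn mulKVg mulKg.
under eq_bigr do rewrite tr_block.
by rewrite sumr_const card_ord -[LHS]mulr_natl mulVKf ?card_group_neq0.
Qed.

(* Consecutive powers of a nontrivial element are not both trivial. *)
Lemma shift_projector_mul_tr_le x y : x != y ->
  \tr (shift_projector x *m shift_projector y) <= N / 2.
Proof.
rewrite eq_mulVg1 => xy; rewrite shift_projector_mul_tr ler_pdivlMr //.
rewrite mulr_natr mulr2n.
set g := (x^-1 * y)%g in xy *.
(* Twice the count is the count plus its shift by one, so each [c] contributes at most 1. *)
rewrite -{2}(sum_powers_shift (fun z => (z == 1%g)%:R : C) g 1) -big_split /=.
rewrite -[X in _ <= X%:R]card_ord -sumr_const; apply: ler_sum => c _.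
rewrite add1n expgS; case: eqP => [->|_]; last by rewrite add0r lern1 leq_b1.
by rewrite mulg1 (negbTE xy) addr0.
Qed.

End HiddenShiftProjector.

(** * Upper and lower bounds on the optimal success probability *)

Section SuccessProbability.
Variables (R : realType) (gT : finGroupType).
Local Notation C := R[i].
Local Notation N := (#|gT|%:R : C).
Local Notation Q := (shift_projector R).

Definition success_value k
    (M : gT -> 'M[C]_((#|gT| * gcard [set: gT]) ^ k)) : R :=
  \sum_h #|gT|%:R^-1 *
    complex.Re (\tr (M h *m ntensmx (hidden_shift_state R h) k)).

(** One factor of the exponent [k.+1] comes from the uniform prior, the other [k] from normalizing
    the copies of the state. *)
Lemma success_valueE k (M : gT -> 'M[C]_((#|gT| * gcard [set: gT]) ^ k)) :
  success_value M =
  #|gT|%:R ^- k.+1 * complex.Re (\sum_h \tr (M h *m ntensmx (Q h) k)).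
Proof.
rewrite raddf_sum mulr_sumr; apply: eq_bigr => h _.
have -> : hidden_shift_state R h = N^-1 *: Q h.
  by rewrite scalerA mulVf ?scale1r ?card_group_neq0.
have ReM (a : R) (z : C) : complex.Re (a%:C%C * z) = a * complex.Re z.
  by case: z => u v; rewrite /= mul0r subr0.
rewrite ntensmxZ -scalemxAr mxtraceZ.
have -> : N^-1 ^+ k = ((#|gT|%:R : R)^-1 ^+ k)%:C%C.
  by rewrite rmorphXn fmorphV rmorph_nat.
by rewrite ReM mulrA -exprS exprVn.
Qed.

Lemma Re_le (x y : C) : x <= y -> complex.Re x <= complex.Re y.
Proof. by rewrite lecE => /andP[]. Qed.

Lemma Re_natr n : complex.Re (n%:R : C) = n%:R :> R.
Proof. by rewrite -(rmorph_nat (real_complex R)). Qed.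

Lemma success_value_le k (M : gT -> 'M[C]_((#|gT| * gcard [set: gT]) ^ k))
    (P : 'M[C]_(#|gT| * gcard [set: gT])) (t : nat) :
  povm M -> projmx P -> (forall h, P *m Q h = Q h) -> \tr P = t%:R ->
  success_value M <= #|gT|%:R ^- k.+1 * t%:R ^+ k.
Proof.
move=> [M_ge0 M1] P_proj PQ Pt; rewrite success_valueE; apply: ler_wpM2l.
  by rewrite invr_ge0 exprn_ge0.
rewrite -natrX -Re_natr natrX -Pt -mxtrace_ntens; apply: Re_le.
apply: trace_povm_projmx_le => //.
- exact: projmx_ntens.
- by move=> h; apply: projmx_ntens; exact: shift_projector_proj.
- by move=> h; rewrite -ntensmx_mul PQ.
Qed.

(** Without this [sup] could be a default value. Always guessing [1] is a measurement, and the
    projector [1%:M] provides the upper bound. *)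
Lemma has_sup_success_value k :
  has_sup [set success_value M | M in [set M | povm M]
    : set (gT -> 'M[C]_((#|gT| * gcard [set: gT]) ^ k))].
Proof.
split.
  exists (@success_value k (fun h => if h == 1%g then 1%:M else 0)).
  exists (fun h => if h == 1%g then 1%:M else 0) => //; split.
    move=> h v; apply: projmx_form_ge0.
    by case: ifP => _; [exact: projmx1 | exact: projmx0].
  by rewrite -big_mkcond big_pred1_eq.
exists (#|gT|%:R ^- k.+1 * (#|gT| * gcard [set: gT])%:R ^+ k).
move=> _ [M M_povm <-]; apply: (success_value_le M_povm (projmx1 _ _)).
  by move=> h; rewrite mul1mx.
by rewrite mxtrace1.
Qed.

Lemma success_probability_le k (P : 'M[C]_(#|gT| * gcard [set: gT])) (t : nat) :
  projmx P -> (forall h, P *m Q h = Q h) -> \tr P = t%:R ->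
  success_probability (fun _ : gT => (#|gT|%:R : R)^-1)
    (fun h : gT => ntensmx (hidden_shift_state R h) k)
  <= #|gT|%:R ^- k.+1 * t%:R ^+ k.
Proof.
move=> P_proj PQ Pt; apply: ge_sup; first by case: (has_sup_success_value k).
by move=> _ [M M_povm <-]; exact: success_value_le M_povm P_proj PQ Pt.
Qed.

Lemma success_probability_ge k : (forall x y : gT, x * y = y * x)%g ->
  1 - #|gT|%:R / 2 ^+ k <=
  success_probability (fun _ : gT => (#|gT|%:R : R)^-1)
    (fun h : gT => ntensmx (hidden_shift_state R h) k).
Proof.
move=> mulgC.
have Qk_proj (h : gT) : projmx (ntensmx (Q h) k).
  exact/projmx_ntens/shift_projector_proj.
have Qk_comm (x y : gT) : ntensmx (Q x) k *m ntensmx (Q y) k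
                 = ntensmx (Q y) k *m ntensmx (Q x) k.
  by rewrite -(ntensmx_mul (Q x)) shift_projector_comm ?ntensmx_mul.
have [M [L [[M_proj L_proj] ML1 M_ge _ LC]]] :=
  sequential_measurement Qk_proj Qk_comm (enum_uniq gT).
have L'_proj b : projmx (if b then L else 0) by case: b => //; exact: projmx0.
(* The failure event is assigned to the arbitrary guess [1], which makes the measurement
   complete. *)
pose M' h := M h + (if h == 1%g then L else 0).
have M'_povm : povm M'.
  split=> [h v|].
    by rewrite mulmxDr mulmxDl mxE addr_ge0 ?projmx_form_ge0.
  by rewrite big_split /= -[RHS]ML1 big_enum -big_mkcond big_pred1_eq.
apply: le_trans (ub_le_sup (proj2 (has_sup_success_value k)) _); last first.
  by exists M'; [exact: M'_povm | reflexivity].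
(* [N ^+ k] is the trace of the tensor power of [Q h]; fewer than [N] other outcomes each overlap
   with it by at most [(N / 2) ^+ k]. *)
have tr_ge h : N ^+ k - N * (N / 2) ^+ k <= \tr (M' h *m ntensmx (Q h) k).
  rewrite mulmxDl raddfD /=.
  apply: (@le_trans _ _ (\tr (M h *m ntensmx (Q h) k))).
    apply: le_trans (M_ge h _); last by rewrite mem_enum.
    rewrite mxtrace_ntens shift_projector_tr lerD2l lerN2 big_enum_cond /=.
    apply: (@le_trans _ _ (\sum_(j | j != h) (N / 2) ^+ k)).
      apply: ler_sum => j jh; rewrite -ntensmx_mul mxtrace_ntens.
      have := shift_projector_mul_tr_le R mulgC jh.
      apply: lerXn2r; rewrite ?nnegrE ?divr_ge0 //.
      apply/projmx_trace_ge0/projmxM; try exact: shift_projector_comm;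
        exact: shift_projector_proj.
    rewrite sumr_const -[leLHS]mulr_natl ler_wpM2r ?exprn_ge0 ?divr_ge0 //.
    by rewrite ler_nat max_card.
  rewrite lerDl; case: ifP => _; last by rewrite mul0mx mxtrace0.
  exact/projmx_trace_ge0/projmxM.
rewrite -/(success_value M') success_valueE.
have n0 := card_group_neq0 gT R.
apply: (@le_trans _ _ (#|gT|%:R ^- k.+1 *
    complex.Re (\sum_(h : gT) (N ^+ k - N * (N / 2) ^+ k)))); last first.
  apply: ler_wpM2l; first by rewrite invr_ge0 exprn_ge0.
  by apply: Re_le; apply: ler_sum => h _.
(* The bound is a real number embedded in the complex field, so its real part can be read off. *)
have -> : N ^+ k - N * (N / 2) ^+ k =
    (#|gT|%:R ^+ k - #|gT|%:R * (#|gT|%:R / 2) ^+ k : R)%:C%C.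
  by rewrite rmorphB rmorphM !rmorphXn rmorphM fmorphV !rmorph_nat.
rewrite raddf_sum /= sumr_const -[(_ - _) *+ _]mulr_natl expr_div_n exprS.
rewrite le_eqVlt; apply/orP; left; apply/eqP; field.
by rewrite !expf_neq0 ?n0.
Qed.

End SuccessProbability.

(** * A common support for all the states in exponent two *)

Section ExponentTwo.
Variables (R : realType) (gT : finGroupType).
Local Notation C := R[i].
Local Notation N := (#|gT|%:R : C).
Hypothesis even_card : ~~ odd #|gT|.

Lemma sum_same_parity (F : numFieldType) n (p : bool) : ~~ odd n ->
  \sum_(c < n) (p == odd c)%:R = n%:R / 2 :> F.
Proof.
move=> /even_halfK <-; elim: (n./2) => [|m IH]; first by rewrite big_ord0 mul0r.
rewrite doubleS !big_ord_recr /= IH odd_double -[m.*2.+2]addn2 natrD.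
by case: p {IH} => /=; field.
Qed.

(* When [gT] has exponent 2, the 2|G|-dimensional range of this projector
   contains the supports of all the states. *)
Definition parity_projector : 'M[C]_(#|gT| * gcard [set: gT]) :=
  tensblock (fun b c : 'I_#|gT| => (2 / N * (odd b == odd c)%:R)%:M).

Lemma parity_projector_proj : projmx parity_projector.
Proof.
split.
  rewrite tensblock_adj; apply: eq_tensblock => b c.
  rewrite tr_scalar_mx map_scalar_mx; congr _%:M.
  by rewrite rmorphM rmorphM fmorphV !rmorph_nat eq_sym.
rewrite tensblock_mul; apply: eq_tensblock => b d.
rewrite (eq_bigr (fun c : 'I_#|gT| =>
  ((2 / N) ^+ 2 * (odd b == odd d)%:R * (odd b == odd c)%:R)%:M)) => [|c _].
  (* Half of the middle indices have the parity of [b], and [(2 / N) ^+ 2 * (N / 2)] is again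
     [2 / N]. *)
  rewrite -raddf_sum /= -mulr_sumr sum_same_parity //; congr _%:M.
  have := card_group_neq0 gT C => N0; field.
  exact: N0.
rewrite -scalar_mxM; congr _%:M.
rewrite mulrACA -expr2 -[RHS]mulrA -!natrM !mulnb; congr (_ * _%:R).
by case: (odd b) (odd c) (odd d) => [] [] [].
Qed.

Lemma parity_projector_tr : \tr parity_projector = (2 * #|gT|)%:R.
Proof.
rewrite tensblock_tr; under eq_bigr do rewrite eqxx mulr1 mxtrace_scalar.
rewrite sumr_const card_ord /gcard cardsT -mulrnA -[LHS]mulr_natr !natrM.
have := card_group_neq0 gT C => N0; field.
exact: N0.
Qed.

(** The projector averages block rows over indices of equal parity, and block row [b] of
    [shift_projector R h] depends only on the parity of [b]. *)
Lemma parity_projector_shift h : (forall x : gT, x ^+ 2 = 1)%g ->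
  parity_projector *m shift_projector R h = shift_projector R h.
Proof.
move=> sqg1; rewrite shift_projectorE tensblock_mul; apply: eq_tensblock => b d.
have expg_odd m : (h ^+ m = h ^+ odd m)%g.
  by rewrite -{1}[m]odd_double_half expgD -mul2n expgM sqg1 expg1n mulg1.
transitivity (\sum_(c < #|gT|) (2 / N * (odd b == odd c)%:R) *:
    (N^-1 *: regular_repr C [set: gT]%G (h ^+ b * h ^- d)%g)).
  apply: eq_bigr => c _; rewrite mul_scalar_mx.
  case: eqP => [bc|_]; last by rewrite mulr0 !scale0r.
  by rewrite (expg_odd c) -bc -expg_odd.
rewrite -scaler_suml -mulr_sumr sum_same_parity // -[RHS]scale1r.
congr (_ *: _).
have := card_group_neq0 gT C => N0; field.
exact: N0.
Qed.

End ExponentTwo.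

(** * Sample complexity of the elementary abelian 2-groups *)

Section ElementaryAbelian.
Variable R : realType.

Lemma card_rV2 n : #|'rV['Z_2]_n| = (2 ^ n)%N.
Proof. by rewrite card_mx card_ord mul1n. Qed.

Lemma discriminable_rV2 n : discriminable R 'rV['Z_2]_n n.+2.
Proof.
apply: le_trans (success_probability_ge R n.+2 _); last exact: addrC.
rewrite card_rV2 natrX !exprS.
have p0 : (2 ^+ n : R) != 0 by rewrite expf_neq0 ?pnatr_eq0.
(* Two samples beyond [n] bring the union bound to 1/4, whereas one would leave only success 1/2. *)
have -> : 1 - 2 ^+ n / (2 * (2 * 2 ^+ n)) = 3 / 4 :> R by field.
lra.
Qed.

Lemma discriminable_rV2_ge n k : discriminable R 'rV['Z_2]_n k -> (n <= k)%N.
Proof.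
(* The parity projector needs a group of even order, which excludes [n = 0], where the claim is
   trivial. *)
case: n => // n disc.
have even_card : ~~ odd #|'rV['Z_2]_n.+1| by rewrite card_rV2 oddX.
have sqg1 (x : 'rV['Z_2]_n.+1) : (x ^+ 2 = 1)%g.
  rewrite expgS expg1; apply/rowP => i; rewrite !mxE.
  by case: (x 0 i) => [[|[|]]] // ?; exact: val_inj.
have := le_trans disc (success_probability_le k
  (parity_projector_proj R even_card)
  (fun h => parity_projector_shift R even_card h sqg1)
  (parity_projector_tr R _)).
rewrite card_rV2 natrM exprMn exprS natrX.
set N : R := 2 ^+ n.+1.
have N0 : N != 0 by rewrite expf_neq0 ?pnatr_eq0.
have -> : (N * N ^+ k)^-1 * (2 ^+ k * N ^+ k) = 2 ^+ k / N.
  by field; rewrite N0 expf_neq0.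
(* With one sample fewer than the exponent, or still fewer, the bound [2 ^+ k / N] is at most 1/2,
   below 2/3. *)
rewrite ltnNge; apply: contraTN => kn; rewrite -ltNge.
have : (2 ^+ k : R) <= 2 ^+ n by rewrite ler_eXn2l ?ltr1n.
rewrite ltr_pdivrMr ?exprn_gt0 // /N exprS.
have : 0 < (2 ^+ n : R) by rewrite exprn_gt0.
lra.
Qed.

End ElementaryAbelian.

Theorem mainTheorem3 (R : realType) :
  exists kmin : nat -> nat,
    (forall n : nat, is_sample_complexity R 'rV['Z_2]_n (kmin n)) /\
    ((fun n => (kmin n)%:R : R) =Theta_\oo (fun n => ln (#|'rV['Z_2]_n|%:R : R))).
Proof.
(* A boolean form of the property, as [ex_minn] requires. *)
pose ok n k := (1 <= k)%N && `[< discriminable R 'rV['Z_2]_n k >].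
have ok_ex n : exists k, ok n k.
  by exists n.+2; apply/andP; split=> //; exact/asboolP/discriminable_rV2.
exists (fun n => ex_minn (ok_ex n)); split=> [n|].
  case: ex_minnP => k /andP[k1 /asboolP disc] kmin; split=> // l l1 ldisc.
  by apply: kmin; rewrite /ok l1; exact/asboolP.
have kmin_bounds n : (n <= ex_minn (ok_ex n) <= n.+2)%N.
  case: ex_minnP => k /andP[_ /asboolP disc] kmin.
  rewrite (discriminable_rV2_ge disc) kmin // /ok /=.
  exact/asboolP/discriminable_rV2.
have ln2 : 0 < ln (2 : R) by rewrite ln_gt0 // ltr1n.
(* The logarithm of the group order is [n] times [ln 2], so these constants turn the claim into the
   bounds [n] and [3 * n] on the sample complexity. *)
rewrite eqThetaE qualifE; apply/asboolP; exists ((ln 2)^-1, 3 / ln 2) => /=.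
  by rewrite invr_gt0 ln2 divr_gt0.
near=> n.
(* This gives [n + 2 <= 3 * n]; at [n = 0] the logarithm vanishes while at least one sample is
   taken. *)
have n1 : (1 <= n)%N by near: n; exact: nbhs_infty_ge.
rewrite card_rV2 natrX lnXn // -(mulr_natr (ln 2)) normrM !ger0_norm //;
  last exact: ltW.
rewrite mulKf ?gt_eqF // mulrA mulfVK ?gt_eqF //.
have /andP[lo hi] := kmin_bounds n.
split; first by rewrite ler_nat.
rewrite -natrM ler_nat; apply: leq_trans hi _.
by rewrite mulSn -addn2 leq_add2l mul2n -addnn -[2%N]/(1 + 1)%N leq_add.
Unshelve. all: by end_near.
Qed.
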